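(* Consider a generalized Nash equilibrium problem GNEP$(\theta_i,K_i)_{i\in\Lambda}$ (notation in the context) in which each $C_i\subseteq\mathbb{R}^{n_i}$ is a non-empty closed convex set. Let $\mathcal{C}=\prod_iC_i$, $\mathcal{K}(x)=\prod_{i\in\Lambda}K_i(x)$, $\mathcal{A}=\overline{\mathrm{co}}(\mathcal{K}(\mathcal{C}))$ and $$f(y,z)=\sum_{i\in\Lambda}\langle-\nabla_{y_i}\theta_i(y),z_i-y_i\rangle .$$ Assume that: (i) each $\theta_i:\mathbb{R}^n\to\mathbb{R}$ is continuously differentiable and $\theta_i(\cdot,x_{-i})$ is concave for every $x_{-i}$; (ii) each $K_i:\mathcal{C}\rightrightarrows\mathbb{R}^{n_i}$ is a closed lower semicontinuous map such that $K_i(x)$ is non-empty, closed and convex for every $x\in\mathcal{C}$; (iii) $f(x,y)+f(y,x)\le0$ for all $x,y\in\mathcal{A}$, and for any sequence $(u_m)_{m\in\mathbb{N}}\subset\mathcal{A}$ with $\lim_m\|u_m\|=\infty$ there exist $z\in\mathcal{A}$ and $m_0\in\mathbb{N}$ such that $f(u_m,z)\le0$ for all $m\ge m_0$; (iv) the set $S^*=\big\{\bar y\in\bigcap_{z\in\mathcal{C}}\mathcal{K}(z)\;\big|\;f(\bar y,y)\ge0\ \ \forall\,y\in\bigcup_{z\in\mathcal{C}}\mathcal{K}(z)\big\}$ is non-empty. Let $(\gamma_k)$ be a bounded sequence of positive reals, $y_0\in\mathbb{R}^n$, and let $(y_k)$ be the sequence generated by the proximal point algorithm described in the context. Then for every cluster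 point $\bar y$ of $(y_k)$, the point $\bar x=P_{\mathcal{C}}(\bar y)$ is a projected solution of GNEP$(\theta_i,K_i)_{i\in\Lambda}$.
   Context: $\Lambda$ is a finite set of players; player $i$ controls $x_i\in C_i\subseteq\mathbb{R}^{n_i}$, $\sum_in_i=n$, and $x=(x_i,x_{-i})$. $K_i$ is the feasible strategy map and $\theta_i$ the objective to be maximized by player $i$. $P_{\mathcal{C}}$ is the Euclidean projection onto $\mathcal{C}$; $\overline{\mathrm{co}}$ is the closure of the convex hull; $\mathcal{K}(\mathcal{C})=\bigcup_{x\in\mathcal{C}}\mathcal{K}(x)$. $\bar x\in\mathcal{C}$ is a projected solution of GNEP$(\theta_i,K_i)_{i\in\Lambda}$ if there is $\bar y\in\mathcal{K}(\bar x)$ with $\|\bar x-\bar y\|=\inf_{y\in\mathcal{C}}\|y-\bar y\|$ and such that $\bar y$ is a Nash equilibrium over the fixed sets $K_i(\bar x)$, i.e. for each $i$, $\bar y_i$ maximizes $\theta_i(\cdot,\bar y_{-i})$ over $K_i(\bar x)$. A set-valued map $M$ on $\mathcal{C}$ is closed if $x_k\to x$ in $\mathcal{C}$, $y_k\in M(x_k)$, $y_k\to y$ imply $y\in M(x)$; it is lower semicontinuous if for every $(x_k)\subset\mathcal{C}$ with $x_k\to x$ and every $y\in M(x)$ there are $y_k\in M(x_k)$ with $y_k\to y$. Proximal point algorithm: for $k=0,1,2,\dots$ let $x_k=P_{\mathcal{C}}(y_k)$, let $f_k(x,y)=f(x,y)+\gamma_k\langle x-y_k,y-x\rangle$ for $x,y\in\mathcal{A}$,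 and let $y_{k+1}$ be the unique point of $\mathcal{K}(x_k)$ such that $f_k(y_{k+1},y)\ge0$ for all $y\in\mathcal{K}(x_k)$ (such a point exists and is unique under the assumptions). The stopping test is disregarded, so $(y_k)$ is an infinite sequence. *)

(* Defs.v *)
From HB Require Import structures.
From mathcomp Require Import all_boot all_order all_algebra.
From mathcomp Require Import all_classical all_reals all_analysis.

Set Implicit Arguments.
Unset Strict Implicit.
Unset Printing Implicit Defensive.

Import Order.TTheory GRing.Theory Num.Theory.
Import numFieldNormedType.Exports.

Local Open Scope classical_set_scope.
Local Open Scope ring_scope.
Local Open Scope convex_scope.

(* The library norm `|x| on 'rV[R]_n is the sup norm. It yields the usual
   topology, so it is used for limits, closures and derivatives; everything
   metric goes through the Euclidean norm [enorm] below. *)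
Section Euclidean.
Context {R : realType} {n : nat}.
Implicit Types (x y z : 'rV[R]_n) (C : set 'rV[R]_n).

Definition dotp x y : R := \sum_(j < n) x 0 j * y 0 j.

Definition enorm x : R := Num.sqrt (dotp x x).

Definition nearest C y x :=
  C x /\ enorm (x - y) = inf [set enorm (z - y) | z in C].

(* Meaningful when [C] is non-empty, closed and convex; an arbitrary vector
   when [C] has no point nearest to [y]. *)
Definition eproj C y : 'rV[R]_n := get (nearest C y).

Definition convex_hull (A : set 'rV[R]_n) : set 'rV[R]_n :=
  smallest (@convex_set R 'rV[R]_n) A.

Definition gradient (g : 'rV[R]_n -> R) x : 'rV[R]_n :=
  \row_j 'D_(delta_mx 0 j) g x.

Definition C1 (g : 'rV[R]_n -> R) :=
  (forall x, differentiable g x) /\ continuous (gradient g).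

Definition concave_function (g : 'rV[R]_n -> R) :=
  forall (t : {i01 R}) (x y : convex_lmodType 'rV[R]_n),
    (g x : R^o) <| t |> g y <= g (x <| t |> y).

End Euclidean.

Section SetValuedMaps.
Context {R : realType} {n m : nat}.
Implicit Types (C : set 'rV[R]_n) (M : 'rV[R]_n -> set 'rV[R]_m).

Definition closed_map C M :=
  forall (x : nat -> 'rV[R]_n) (y : nat -> 'rV[R]_m) x0 y0,
    (forall k, C (x k)) -> C x0 -> x @ \oo --> x0 ->
    (forall k, M (x k) (y k)) -> y @ \oo --> y0 ->
    M x0 y0.

Definition lsc_map C M :=
  forall (x : nat -> 'rV[R]_n) x0 y0,
    (forall k, C (x k)) -> C x0 -> x @ \oo --> x0 -> M x0 y0 ->
    exists2 y : nat -> 'rV[R]_m,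
      forall k, M (x k) (y k) & y @ \oo --> y0.

End SetValuedMaps.

(* The players are 'I_N; player i controls the block [submxrow x i], of length
   d i, of a joint strategy x, a row vector of length \sum_i d i. The maps
   [K i] are total functions of which only the values on the product set [C]
   matter. *)
Section Game.
Context {R : realType} {N : nat} {d : 'I_N -> nat}.
Local Notation Rn := 'rV[R]_(\sum_i d i).
Implicit Types (x y z : Rn) (C : set Rn).
Implicit Types (theta : 'I_N -> Rn -> R).
Implicit Types (K : forall i, Rn -> set 'rV[R]_(d i)).

Definition prod_set (D : forall i, set 'rV[R]_(d i)) : set Rn :=
  [set x | forall i, D i (submxrow x i)].

Definition prod_map K x : set Rn := prod_set (fun i => K i x).

(* (u, x_{-i}) *)
Definition set_block x i (u : 'rV[R]_(d i)) : Rn :=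
  \mxrow_j dfwith (submxrow x) i u j.

Definition strategies C K : set Rn := \bigcup_(x in C) prod_map K x.

Definition hull_strategies C K : set Rn :=
  closure (convex_hull (strategies C K)).

Definition nash_bifun theta y z : R :=
  \sum_i dotp (- submxrow (gradient (theta i) y) i)
              (submxrow z i - submxrow y i).

Definition nash_equilibrium theta (D : forall i, set 'rV[R]_(d i)) y :=
  forall i, D i (submxrow y i) /\
    forall u, D i u -> theta i (set_block y u) <= theta i y.

Definition projected_solution C theta K x :=
  exists y, [/\ prod_map K x y, nearest C y x &
                nash_equilibrium theta (fun i => K i x) y].

Definition Sstar C theta K : set Rn :=
  [set y | (\bigcap_(z in C) prod_map K z) y /\
           forall z, strategies C K z -> 0 <= nash_bifun theta y z].

Definition proximal_bifun (f : Rn -> Rn -> R) (c : R) w x y : R :=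
  f x y + c * dotp (x - w) (y - x).

Definition proximal_sequence C K (f : Rn -> Rn -> R) (gamma : nat -> R) (y0 : Rn)
    (y : nat -> Rn) :=
  y 0%N = y0 /\
  forall k, let x := eproj C (y k) in
    prod_map K x (y k.+1) /\
    forall z, prod_map K x z ->
      0 <= proximal_bifun f (gamma k) (y k) (y k.+1) z.

End Game.

Arguments set_block {R N d} x i u.

(* Main.v *)
(* Testing the step k -> k + 1 against a point s of S* gives, by monotonicity,
   <y_{k+1} - y_k, s - y_{k+1}> >= 0, hence
   |y_{k+1} - s|^2 + |y_{k+1} - y_k|^2 <= |y_k - s|^2: the distances to s decrease
   and y_{k+1} - y_k tends to 0. Along indices n_j with y_{n_j} -> ybar, also
   y_{n_j + 1} -> ybar and P_C(y_{n_j}) -> P_C(ybar), so ybar is in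
   K(P_C(ybar)) because K is closed. Given u in K_i(P_C(ybar)), lower
   semicontinuity approximates u by points of K_i(P_C(y_{n_j})); passing to the
   limit in the proximal inequality tested at the corresponding deviation of
   player i alone gives <-grad_i theta_i(ybar), u - ybar_i> >= 0, which by
   concavity says that deviating to u does not improve on ybar_i. *)
Require Import Defs.
From HB Require Import structures.
From mathcomp Require Import all_boot all_order all_algebra.
From mathcomp Require Import all_classical all_reals all_analysis.
From mathcomp Require Import ring lra.

Set Implicit Arguments.
Unset Strict Implicit.
Unset Printing Implicit Defensive.

Import Order.TTheory GRing.Theory Num.Theory.
Import numFieldNormedType.Exports.

Local Open Scope classical_set_scope.
Local Open Scope ring_scope.

(** * Euclidean inner product and projection onto a closed convex set *)

Section EuclideanSpace.
Context {R : realType} {n : nat}.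
Implicit Types (x y z : 'rV[R]_n) (C : set 'rV[R]_n).

Lemma dotpC x y : dotp x y = dotp y x.
Proof. by apply: eq_bigr => j _; rewrite mulrC. Qed.

Lemma dotpDl x y z : dotp (x + y) z = dotp x z + dotp y z.
Proof. by rewrite -big_split; apply: eq_bigr => j _; rewrite mxE mulrDl. Qed.

Lemma dotpZl a x y : dotp (a *: x) y = a * dotp x y.
Proof. by rewrite mulr_sumr; apply: eq_bigr => j _; rewrite mxE mulrA. Qed.

Lemma dotpNl x y : dotp (- x) y = - dotp x y.
Proof. by rewrite -scaleN1r dotpZl mulN1r. Qed.

Lemma dotp0l x : dotp 0 x = 0.
Proof. by rewrite -(scale0r x) dotpZl mul0r. Qed.

Lemma dotpDr x y z : dotp z (x + y) = dotp z x + dotp z y.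
Proof. by rewrite !(dotpC z) dotpDl. Qed.

Lemma dotpZr a x y : dotp y (a *: x) = a * dotp y x.
Proof. by rewrite !(dotpC y) dotpZl. Qed.

Lemma dotpNr x y : dotp y (- x) = - dotp y x.
Proof. by rewrite !(dotpC y) dotpNl. Qed.

Definition dotpE := (dotpDl, dotpDr, dotpNl, dotpNr, dotpZl, dotpZr).

Lemma dotp_ge0 x : 0 <= dotp x x.
Proof. by apply: sumr_ge0 => j _; rewrite -expr2 sqr_ge0. Qed.

Lemma enorm_le x y : (enorm x <= enorm y) = (dotp x x <= dotp y y).
Proof. by rewrite ler_sqrt// dotp_ge0. Qed.

(** The square of each coordinate is one summand of [dotp x x]. This is how Euclidean estimates
    reach the sup-norm topology, for limits and for boundedness. *)
Lemma normr_le_enorm x : `|x| <= enorm x.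
Proof.
rewrite [leLHS]/Num.norm /= mx_normrE; apply/bigmax_leP; split=> [|[i j] _] /=.
  exact: sqrtr_ge0.
rewrite ord1 -sqrtr_sqr ler_sqrt ?dotp_ge0//.
rewrite /dotp (bigD1 j)//= -expr2 lerDl.
by apply: sumr_ge0 => k _; rewrite -expr2 sqr_ge0.
Qed.

Lemma cvg_dotp (T : Type) (F : set_system T) (FF : Filter F)
    (u v : T -> 'rV[R]_n) x y :
  u @ F --> x -> v @ F --> y -> dotp (u t) (v t) @[t --> F] --> dotp x y.
Proof.
move=> ux vy; apply: cvg_big => [|j _]; first exact: add_continuous.
have cj : continuous (fun M : 'rV[R]_n => M 0 j) by exact: coord_continuous.
by apply: cvgM; [exact: (cvg_comp _ _ ux (cj x))|exact: (cvg_comp _ _ vy (cj y))].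
Qed.

Lemma cvg_enorm_sub (T : Type) (F : set_system T) (FF : Filter F)
    (u : T -> 'rV[R]_n) x :
  enorm (u t - x) @[t --> F] --> (0 : R) -> u @ F --> x.
Proof.
move=> ux; apply/subr_cvg0/norm_cvg0P.
apply: squeeze_cvgr (cvg_cst 0) ux.
by near=> t; rewrite normr_ge0 normr_le_enorm.
Unshelve. all: by end_near. Qed.

Lemma cvg_enorm (T : Type) (F : set_system T) (FF : Filter F)
    (u : T -> 'rV[R]_n) x : u @ F --> x -> enorm (u t) @[t --> F] --> enorm x.
Proof.
move=> ux; exact: (cvg_comp _ _ (cvg_dotp FF ux ux) (@sqrt_continuous R _)).
Qed.

Lemma nearestP C y x :
  nearest C y x <-> C x /\ forall z, C z -> enorm (x - y) <= enorm (z - y).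
Proof.
have lb : has_lbound [set enorm (z - y) | z in C].
  by exists 0 => _ [z _ <-]; exact: sqrtr_ge0.
split=> [[Cx xE]|[Cx xmin]]; split=> //.
  by move=> z Cz; rewrite xE; apply: (ge_inf lb); exists z.
apply/eqP; rewrite eq_le; apply/andP; split.
  by apply: lb_le_inf => [|_ [z Cz <-]]; [exists (enorm (x - y)), x|exact: xmin].
by apply: (ge_inf lb); exists x.
Qed.

Lemma nearest_exists C y : C !=set0 -> closed C -> exists x, nearest C y x.
Proof.
move=> [c Cc] clC.
pose e z := enorm (z - y).
have ce : continuous e.
  move=> z; apply: (@cvg_enorm _ (nbhs z) _ (fun t => t - y)).
  by apply: cvgB; [exact: cvg_id|exact: cvg_cst].
(* Only points at least as close to [y] as [c] compete for the minimum, and they form a compact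
   set. *)
pose B := C `&` e @^-1` [set t | t <= e c].
have Bc : B c by split => //=.
have Bcompact : compact B.
  have Bclosed : closed B.
    apply: (closedI clC); apply: (closed_comp (fun z _ => ce z)).
    exact: (@closed_le _ (e c)).
  apply: (bounded_closed_compact _ Bclosed).
  apply/(@ex_bound _ _ _ id (globally B) (globally_properfilter Bc)).
  exists (`|y| + e c) => z [_ /= ez].
  rewrite -(subrK y z) addrC (le_trans (ler_normD _ _))// lerD2l.
  by rewrite (le_trans (normr_le_enorm _)).
have [||x /set_mem[Cx xc] xmin] := @EVT_min_rV R n e B _ Bcompact.
- by exists c.
- exact: continuous_subspaceT.
exists x; apply/nearestP; split=> // z Cz.
have [zc|/ltW zc] := leP (e z) (e c); first by apply/xmin/mem_set.
exact: le_trans zc.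
Qed.

Lemma eprojP C y : C !=set0 -> closed C -> nearest C y (eproj C y).
Proof. by move=> C0 clC; apply: getPex; exact: nearest_exists. Qed.

Lemma convex_set_line C x y (t : R) : convex_set C -> C x -> C y ->
  0 <= t -> t <= 1 -> C (t *: x + (1 - t) *: y).
Proof.
move=> cC Cx Cy t0 t1.
exact/set_mem/(cC x y (Itv01 t0 t1) (mem_set Cx) (mem_set Cy)).
Qed.

(* If [a := dotp (y - x) (z - x)] were positive, moving from [x] towards [z] by
   the fraction [a / (a + b)], with [b := dotp (z - x) (z - x)], would bring us
   closer to [y]. *)
Lemma nearest_obtuse C y x z :
  convex_set C -> nearest C y x -> C z -> dotp (y - x) (z - x) <= 0.
Proof.
move=> cC /nearestP[Cx xmin] Cz; rewrite leNgt; apply/negP => a0.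
set a := dotp (y - x) (z - x) in a0; pose b := dotp (z - x) (z - x).
have b0 : 0 <= b := dotp_ge0 _.
have ab0 : 0 < a + b by lra.
pose t := a / (a + b).
have t0 : 0 < t by rewrite divr_gt0.
have t1 : t <= 1 by rewrite ler_pdivrMr// mul1r; lra.
have tb : t * b <= a by rewrite /t mulrAC ler_pdivrMr// ler_wpM2l//; lra.
have Ct : C (t *: z + (1 - t) *: x) by apply: convex_set_line => //; exact: ltW.
have := xmin _ Ct; rewrite enorm_le.
have -> : t *: z + (1 - t) *: x - y = t *: (z - x) - (y - x).
  by apply/rowP => j; rewrite !mxE; ring.
have -> : x - y = - (y - x) by rewrite opprB.
have : t * (t * b - 2 * a) < 0 by rewrite pmulr_rlt0//; lra.
move: (t) => s; rewrite /a /b; move: (z - x) (y - x) => u v.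
rewrite !dotpE (dotpC u v); lra.
Qed.

(** Adding the hypotheses gives |p - q|^2 <= <x - y, p - q>; expanding |(x - y) - (p - q)|^2 >= 0
    then replaces an appeal to Cauchy-Schwarz. *)
Lemma dotp_obtuse_le x y p q :
  dotp (x - p) (q - p) <= 0 -> dotp (y - q) (p - q) <= 0 ->
  dotp (p - q) (p - q) <= dotp (x - y) (x - y).
Proof.
move=> hx hy.
have pq : dotp (p - q) (p - q) <= dotp (x - y) (p - q).
  rewrite -subr_ge0 -oppr_le0; apply: le_trans (ler_wnDl hx hy).
  by rewrite !dotpE (dotpC q p) le_eqVlt; apply/orP; left; apply/eqP; ring.
have := dotp_ge0 ((x - y) - (p - q)).
move: {hx hy} (x - y) (p - q) pq => u v uv.
rewrite !dotpE (dotpC v u).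
lra.
Qed.

Lemma eproj_nonexpansive C x y : C !=set0 -> closed C -> convex_set C ->
  enorm (eproj C x - eproj C y) <= enorm (x - y).
Proof.
move=> C0 clC cC; rewrite enorm_le.
have Px := eprojP x C0 clC; have Py := eprojP y C0 clC.
by apply: dotp_obtuse_le; apply: (nearest_obtuse cC) => //; [case: Py|case: Px].
Qed.

Lemma cvg_eproj (T : Type) (F : set_system T) (FF : Filter F)
    (u : T -> 'rV[R]_n) C x : C !=set0 -> closed C -> convex_set C ->
  u @ F --> x -> eproj C (u t) @[t --> F] --> eproj C x.
Proof.
move=> C0 clC cC ux; apply: cvg_enorm_sub.
have e0 : enorm (u t - x) @[t --> F] --> (0 : R).
  have -> : 0 = enorm (x - x) :> R.
    by rewrite /enorm subrr dotp0l sqrtr0.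
  by apply: cvg_enorm; apply: cvgB => //; exact: cvg_cst.
apply: squeeze_cvgr (cvg_cst 0) e0.
by near=> t; rewrite sqrtr_ge0 eproj_nonexpansive.
Unshelve. all: by end_near. Qed.

End EuclideanSpace.

(** * Directional derivatives and the concave gradient inequality *)

Section Differential.
Context {R : realType} {n : nat}.
Implicit Types (g : 'rV[R]_n -> R) (x h : 'rV[R]_n).

Lemma derive_gradient g x h :
  differentiable g x -> 'D_h g x = dotp (gradient g x) h.
Proof.
move=> dg; rewrite deriveE// [in LHS](row_sum_delta h) linear_sum.
by apply: eq_bigr => j _; rewrite linearZ mxE /= deriveE// mulrC.
Qed.

(** Dividing the hypothesis by [t] bounds every difference quotient on (0, 1] below by
    [g (h + x) - g x]; let [t] decrease to 0. *)
Lemma concave_slope_le_derive g x h : derivable g x h ->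
  (forall t : R, 0 < t -> t <= 1 ->
     t * g (h + x) + (1 - t) * g x <= g (t *: h + x)) ->
  g (h + x) - g x <= 'D_h g x.
Proof.
move=> dg cg; apply: (ler_cvg_to (cvg_cst _) (cvg_dnbhs_at_right dg)).
near=> t.
have t0 : 0 < t by near: t; exact: nbhs_right_gt.
have t1 : t <= 1 by near: t; exact: nbhs_right_le.
rewrite /= [_ *: _]mulrC ler_pdivlMr//; have := cg t t0 t1; lra.
Unshelve. all: by end_near. Qed.

End Differential.

(** * Block decomposition of joint strategies and unilateral deviations *)

Section Blocks.
Context {R : realType} {N : nat} {d : 'I_N -> nat}.
Local Notation Rn := 'rV[R]_(\sum_i d i).
Implicit Types (x y w : Rn) (theta : 'I_N -> Rn -> R).
Implicit Type D : forall i, set 'rV[R]_(d i).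

Lemma submxrowZ (a : R) x i : submxrow (a *: x) i = a *: submxrow x i.
Proof. by apply/rowP => j; rewrite !mxE. Qed.

Lemma cvg_submxrow (T : Type) (F : set_system T) (FF : Filter F)
    (u : T -> Rn) x i :
  u @ F --> x -> submxrow (u t) i @[t --> F] --> submxrow x i.
Proof.
move=> /cvg_ballP ux; apply/cvg_ballP => e /ux; apply: filterS => t [e0 xu].
by split=> // k j; rewrite !mxE; exact: xu.
Qed.

Lemma prod_set_nonempty D : (forall i, D i !=set0) -> prod_set D !=set0.
Proof.
move=> D0; exists (\mxrow_i get (D i)) => i; rewrite mxrowK.
exact: getPex (D0 i).
Qed.

Lemma prod_set_closed D : (forall i, closed (D i)) -> closed (prod_set D).
Proof.
move=> clD.
have -> : prod_set D = \bigcap_i (fun x => submxrow x i) @^-1` D i.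
  by apply/seteqP; split=> [x Dx i _|x Dx i]; [exact: Dx|exact: Dx i I].
apply: closed_bigI => i _; apply: preimage_closed (clD i) => x _.
exact: (@cvg_submxrow _ (nbhs x) _ id x i (@cvg_id _ _)).
Qed.

Lemma prod_set_convex D :
  (forall i, convex_set (D i)) -> convex_set (prod_set D).
Proof.
move=> cD x y t /set_mem Dx /set_mem Dy; apply/mem_set => i.
rewrite submxrowD !submxrowZ; apply: set_mem.
exact: (cD i _ _ t (mem_set (Dx i)) (mem_set (Dy i))).
Qed.

Lemma dotp_submxrow x y :
  dotp x y = \sum_i dotp (submxrow x i) (submxrow y i).
Proof.
have dotpM n (a b : 'rV[R]_n) : dotp a b = (a *m b^T) 0 0.
  by rewrite mxE; apply: eq_bigr => j _; rewrite mxE.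
rewrite dotpM -{1}[x]submxrowK -{1}[y]submxrowK tr_mxrow mul_mxrow_mxcol summxE.
by apply: eq_bigr => i _; rewrite dotpM.
Qed.

Lemma submxrow_set_block x i u : submxrow (set_block x i u) i = u.
Proof. by rewrite mxrowK dfwithin. Qed.

Lemma submxrow_set_block_neq x i u j :
  i != j -> submxrow (set_block x i u) j = submxrow x j.
Proof. by move=> ij; rewrite mxrowK dfwithout. Qed.

(** Only block [i] changes, so all other summands vanish. Used both for the Nash bifunction and for
    the proximal term. *)
Lemma sum_dotp_set_block (a : forall j, 'rV[R]_(d j)) y i u :
  \sum_j dotp (a j) (submxrow (set_block y i u) j - submxrow y j) =
  dotp (a i) (u - submxrow y i).
Proof.
rewrite (bigD1 i)//= submxrow_set_block big1 ?addr0// => j ji.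
by rewrite submxrow_set_block_neq 1?eq_sym// subrr dotpC dotp0l.
Qed.

Lemma nash_bifun_set_block theta y i u :
  nash_bifun theta y (set_block y i u) =
  dotp (- submxrow (gradient (theta i) y) i) (u - submxrow y i).
Proof. exact: (sum_dotp_set_block (fun j => - submxrow (gradient (theta j) y) j)). Qed.

Lemma dotp_sub_set_block w y i u :
  dotp w (set_block y i u - y) = dotp (submxrow w i) (u - submxrow y i).
Proof.
rewrite dotp_submxrow -(sum_dotp_set_block (fun j => submxrow w j)).
by apply: eq_bigr => j _; rewrite submxrowB.
Qed.

(** Turns a convex combination inside block [i] into a point on the line through [y] along the
    deviation, the form in which a directional derivative can be taken. *)
Lemma set_block_conv y i u (t : R) :
  set_block y i (t *: u + (1 - t) *: submxrow y i) =
  t *: (set_block y i u - y) + y.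
Proof.
apply/mxrowP => j; rewrite submxrowD submxrowZ submxrowB.
have [<-|ij] := eqVneq i j.
  by rewrite !submxrow_set_block; apply/rowP => k; rewrite !mxE; ring.
by rewrite !submxrow_set_block_neq// subrr scaler0 add0r.
Qed.

Lemma set_block_submxrow y i : set_block y i (submxrow y i) = y.
Proof.
apply/mxrowP => j; have [<-|ij] := eqVneq i j; first exact: submxrow_set_block.
exact: submxrow_set_block_neq.
Qed.

(** The bifunction at a deviation of player [i] is minus the derivative of [theta i] along it, and
    by concavity this derivative bounds the gain from above. *)
Lemma concave_unilateral_max theta y i u :
  differentiable (theta i) y ->
  concave_function (fun v => theta i (set_block y i v)) ->
  0 <= nash_bifun theta y (set_block y i u) ->
  theta i (set_block y i u) <= theta i y.
Proof.
move=> dth cth; rewrite nash_bifun_set_block dotpNl -dotp_sub_set_block.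
rewrite -derive_gradient// oppr_ge0 => gh; rewrite -subr_le0; apply: le_trans gh.
rewrite -{1}[set_block y i u](subrK y).
apply: concave_slope_le_derive => [|t t0 t1]; first exact: diff_derivable.
rewrite subrK -set_block_conv.
have := cth (Itv01 (ltW t0) t1) u (submxrow y i).
by rewrite convRE /= set_block_submxrow.
Qed.

End Blocks.

(** * Fejer monotonicity and limits of sequences *)

Lemma fejer_step (R : realType) n (a b s : 'rV[R]_n) :
  0 <= dotp (b - a) (s - b) ->
  dotp (b - s) (b - s) + dotp (b - a) (b - a) <= dotp (a - s) (a - s).
Proof.
have -> : a - s = (b - s) - (b - a) by apply/rowP => j; rewrite !mxE; ring.
have -> : s - b = - (b - s) by rewrite opprB.
move: (b - s) (b - a) => u v; rewrite !dotpE (dotpC v u); lra.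
Qed.

(** [e] is nonincreasing and bounded below, hence convergent, so its consecutive differences, which
    dominate [D], tend to 0. *)
Lemma cvg0_telescoping_bound (R : realType) (e D : nat -> R) :
  (forall k, 0 <= e k) -> (forall k, 0 <= D k) ->
  (forall k, e k.+1 + D k <= e k) -> D @ \oo --> (0 : R).
Proof.
move=> e0 D0 eD.
have ce : e @ \oo --> limn e.
  apply: nonincreasing_is_cvgn; last by exists 0 => _ [k _ <-].
  by apply/nonincreasing_seqP => k; have := eD k; have := D0 k; lra.
have de : (e k - e k.+1) @[k --> \oo] --> (0 : R).
  by rewrite -(subrr (limn e)); apply: cvgB => //; rewrite cvg_shiftS.
apply: squeeze_cvgr (cvg_cst 0) de.
by near=> k; rewrite D0 /=; have := eD k; lra.
Unshelve. all: by end_near. Qed.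

(** Choose [s j >= j] with [u (s j)] within 1/(j+1) of [l]. The indices tend to infinity, which is
    enough for composing limits. *)
Lemma cluster_subseq (R : realType) (V : pseudoMetricType R) (u : nat -> V) l :
  cluster (u @ \oo) l ->
  exists2 s : nat -> nat, s @ \oo --> \oo & u (s j) @[j --> \oo] --> l.
Proof.
move=> ul.
have /choice[s sP] j : exists k, (j <= k)%N /\ ball l j.+1%:R^-1 (u k).
  have [||_ [[k jk <-] lk]] := ul (u @` [set k | (j <= k)%N]) (ball l j.+1%:R^-1).
  - by exists j => // k jk; exists k.
  - exact: nbhsx_ballx.
  - by exists k.
exists s.
  by move=> A [M _ MA]; exists M => // j /= Mj; apply/MA/(leq_trans Mj)/(sP j).1.
apply/cvg_ballP => e e0.
near=> j; apply: le_ball (sP j).2; apply/ltW.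
by near: j; exact: (near_infty_natSinv_lt (PosNum e0)).
Unshelve. all: by end_near. Qed.

(** The coefficients [c k] may fail to converge, so [c k * b k] is replaced by its upper bound
    [M * |b k|], which tends to 0. *)
Lemma limit_ge0_bounded_perturbation (R : realType) (M : R) (a b c : nat -> R) l :
  (forall k, `|c k| <= M) -> (forall k, 0 <= a k + c k * b k) ->
  a @ \oo --> l -> b @ \oo --> (0 : R) -> 0 <= l.
Proof.
move=> cM abc al b0.
have abM : (a k + M * `|b k|) @[k --> \oo] --> l.
  rewrite -[l]addr0 -(mulr0 M); apply: cvgD => //; apply: cvgMr.
  exact/norm_cvg0P.
apply: (ler_cvg_to (cvg_cst 0) abM).
near=> k; apply: le_trans (abc k) _; rewrite lerD2l.
by rewrite (le_trans (ler_norm _))// normrM ler_wpM2r.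
Unshelve. all: by end_near. Qed.

(** * Cluster points of the proximal iterates *)

Theorem corollary5p2 (R : realType) (N : nat) (d : 'I_N -> nat)
  (Ci : forall i : 'I_N, set 'rV[R]_(d i))
  (theta : 'I_N -> 'rV[R]_(\sum_i d i) -> R)
  (K : forall i : 'I_N, 'rV[R]_(\sum_i d i) -> set 'rV[R]_(d i))
  (gamma : nat -> R) (y0 : 'rV[R]_(\sum_i d i))
  (y : nat -> 'rV[R]_(\sum_i d i)) :
  let C := prod_set Ci in
  let A := hull_strategies C K in
  let f := nash_bifun theta in
  (forall i, [/\ Ci i !=set0, closed (Ci i) & convex_set (Ci i)]) ->
  (forall i, C1 (theta i)) ->
  (forall i x, concave_function (fun u => theta i (set_block x i u))) ->
  (forall i, closed_map C (K i) /\ lsc_map C (K i)) ->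
  (forall i x, C x -> [/\ K i x !=set0, closed (K i x) & convex_set (K i x)]) ->
  (forall v w, A v -> A w -> f v w + f w v <= 0) ->
  (forall u : nat -> 'rV[R]_(\sum_i d i),
     (forall m, A (u m)) -> enorm (u m) @[m --> \oo] --> +oo ->
     exists2 z, A z & exists m0, forall m, (m0 <= m)%N -> f (u m) z <= 0) ->
  Sstar C theta K !=set0 ->
  bounded_fun gamma ->
  (forall k, 0 < gamma k) ->
  proximal_sequence C K f gamma y0 y ->
  forall ybar, cluster (y @ \oo) ybar ->
    projected_solution C theta K (eproj C ybar).
Proof.
move=> C A f HC c1 cth KM KV mono _ [s [sK sopt]] bgamma gamma0 [_ prox] ybar.
move=> /cluster_subseq[sg sgoo ysg].
have C0 : C !=set0 by apply: prod_set_nonempty => i; case: (HC i).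
have Ccl : closed C by apply: prod_set_closed => i; case: (HC i).
have Ccv : convex_set C by apply: prod_set_convex => i; case: (HC i).
have PC z : nearest C z (eproj C z) by exact: eprojP.
have PCC z : C (eproj C z) by case: (PC z).
have stratA z : strategies C K z -> A z.
  by move=> Kz; apply: subset_closure; exact: sub_gen_smallest.
have step k : 0 <= dotp (y k.+1 - y k) (s - y k.+1).
  (* [s] lies in every [prod_map K z] with [z] in [C], so it is an admissible test point at each
     step. *)
  have [Ky /(_ s (sK _ (PCC _)))] := prox k.
  have Sy : strategies C K (y k.+1) by exists (eproj C (y k)).
  have Ss : strategies C K s by exists (eproj C (y k)) => //; exact: sK.
  have := mono _ _ (stratA _ Sy) (stratA _ Ss).
  have := sopt _ Sy; rewrite /proximal_bifun -/f => f1 f2 f3.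
  (* [f1] and [f2] give [f (y k.+1) s <= 0], so in [f3] the proximal term alone is nonnegative. *)
  rewrite -(pmulr_rge0 _ (gamma0 k)); lra.
have dy0 : dotp (y k.+1 - y k) (y k.+1 - y k) @[k --> \oo] --> (0 : R).
  apply: (@cvg0_telescoping_bound _ (fun k => dotp (y k - s) (y k - s))).
  - by move=> k; exact: dotp_ge0.
  - by move=> k; exact: dotp_ge0.
  - by move=> k; exact: fejer_step.
have dy : (y k.+1 - y k) @[k --> \oo] --> (0 : 'rV[R]_(\sum_i d i)).
  apply: cvg_enorm_sub; under eq_fun do rewrite subr0.
  by rewrite -(sqrtr0 R); exact: (cvg_comp _ _ dy0 (@sqrt_continuous R _)).
have dysg : (y (sg j).+1 - y (sg j)) @[j --> \oo] --> (0 : 'rV[R]_(\sum_i d i)).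
  exact: (cvg_comp _ _ sgoo dy).
have y1sg : y (sg j).+1 @[j --> \oo] --> ybar.
  have : y (sg j) + (y (sg j).+1 - y (sg j)) @[j --> \oo] --> ybar + 0.
    exact: cvgD.
  by rewrite addr0; under eq_cvg do rewrite subrKC.
have xsg : eproj C (y (sg j)) @[j --> \oo] --> eproj C ybar by exact: cvg_eproj.
have Kybar i : K i (eproj C ybar) (submxrow ybar i).
  (* Note the shift: it is [y (sg j).+1] that lies in the constraint set at the projection of
     [y (sg j)]. *)
  apply: ((KM i).1 _ (fun j => submxrow (y (sg j).+1) i) _ _ _ _ xsg) => //.
    by move=> j; case: (prox (sg j)) => + _; exact.
  exact: cvg_submxrow.
exists ybar; split=> // i; split=> // u Ku.
apply: concave_unilateral_max => //; first by case: (c1 i).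
rewrite nash_bifun_set_block.
have [v Kv vu] := (KM i).2 _ _ _ (fun j => PCC (y (sg j))) (PCC _) xsg Ku.
have [M gM] : exists M, forall k, `|gamma k| <= M.
  (* [bounded_fun] provides a bound by each number strictly above [M], hence [M + 1]. *)
  have [M [_ /(_ (M + 1))]] := bgamma; rewrite ltrDl ltr01 => /(_ isT) gM.
  by exists (M + 1) => k; exact: gM.
have vy : (v j - submxrow (y (sg j).+1) i) @[j --> \oo] --> u - submxrow ybar i.
  by apply: cvgB => //; exact: cvg_submxrow.
have gysg : gradient (theta i) (y (sg j).+1) @[j --> \oo] -->
    gradient (theta i) ybar.
  exact: (cvg_comp _ _ y1sg ((c1 i).2 ybar)).
(* The proximal inequality along the subsequence: the gradient term converges to the desired limit,
   while the proximal term is a bounded coefficient times a vanishing product. *)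
apply: (@limit_ge0_bounded_perturbation R M
  (fun j => dotp (- submxrow (gradient (theta i) (y (sg j).+1)) i)
                 (v j - submxrow (y (sg j).+1) i))
  (fun j => dotp (submxrow (y (sg j).+1 - y (sg j)) i)
                 (v j - submxrow (y (sg j).+1) i)) (fun j => gamma (sg j))) => //.
- move=> j; have [Ky] := prox (sg j).
  move=> /(_ (set_block (y (sg j).+1) i (v j))).
  rewrite /proximal_bifun /f nash_bifun_set_block dotp_sub_set_block; apply.
  (* The deviation is feasible because the constraint set is a product: block [i] is [v j], the
     others are those of the feasible [y (sg j).+1]. *)
  move=> l; have [<-|il] := eqVneq i l; first by rewrite submxrow_set_block.
  by rewrite submxrow_set_block_neq.
- exact: (cvg_dotp _ (cvgN (cvg_submxrow _ gysg)) vy).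
- have : dotp (submxrow (y (sg j).+1 - y (sg j)) i)
      (v j - submxrow (y (sg j).+1) i) @[j --> \oo] -->
      dotp (submxrow 0 i) (u - submxrow ybar i).
    exact: (cvg_dotp _ (cvg_submxrow _ dysg) vy).
  by rewrite submxrow0 dotp0l.
Qed.
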